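(* Let $d_1,d_2,X,Y,B$ be positive integers and let $\alpha_{bxy}\in\mathbb{R}$ for $b\in[B]$, $x\in[X]$, $y\in[Y]$. Let $Q^{\mathrm{SEP}}$ denote the maximum of $$\sum_{b,x,y}\alpha_{bxy}\,\mathrm{Tr}(\sigma_x N_b^y)$$ over all families $(\sigma_x)_{x\in[X]}$ of separable density operators on $\mathbb{C}^{d_1}\otimes\mathbb{C}^{d_2}$ and all families of POVMs $(\{N_b^y\}_{b\in[B]})_{y\in[Y]}$ on $\mathbb{C}^{d_1}\otimes\mathbb{C}^{d_2}$. Let $P(b|x,y)$ be a prepare-and-measure correlation whose witness value $$w=\sum_{b,x,y}\alpha_{bxy}\,P(b|x,y)$$ satisfies $w>Q^{\mathrm{SEP}}$. Then for every family of density operators $(\rho_x)_{x\in[X]}$ on $\mathbb{C}^{d_1}\otimes\mathbb{C}^{d_2}$ and every family of POVMs $(\{M_b^y\}_{b\in[B]})_{y\in[Y]}$ on $\mathbb{C}^{d_1}\otimes\mathbb{C}^{d_2}$ such that $P(b|x,y)=\mathrm{Tr}(\rho_x M_b^y)$ for all $b,x,y$, the set $\{\rho_x\}_{x\in[X]}$ is an absolutely entangled set.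
   Context: For a positive integer $N$, $[N]=\{1,\dots,N\}$. A density operator is a positive semidefinite operator of trace one. A density operator on $\mathbb{C}^{d_1}\otimes\mathbb{C}^{d_2}$ is separable if it is a convex combination of product density operators $\sigma^1\otimes\sigma^2$, with $\sigma^1$ a density operator on $\mathbb{C}^{d_1}$ and $\sigma^2$ a density operator on $\mathbb{C}^{d_2}$; otherwise it is entangled. A POVM with outcomes in $[B]$ on $\mathbb{C}^{d_1}\otimes\mathbb{C}^{d_2}$ is a family $\{M_b\}_{b\in[B]}$ of positive semidefinite operators with $\sum_b M_b=\mathbb{I}$. Absolutely entangled set (AES): a set $\{\rho_1,\dots,\rho_m\}$ of density operators on $\mathbb{C}^{d_1}\otimes\mathbb{C}^{d_2}$ is an AES if for every unitary operator $U$ on $\mathbb{C}^{d_1}\otimes\mathbb{C}^{d_2}$ at least one of the transformed states $U\rho_iU^\dagger$ is entangled with respect to the bipartition $\mathbb{C}^{d_1}\otimes\mathbb{C}^{d_2}$. Prepare-and-measure scenario: on input $x\in[X]$ the sender prepares a state $\rho_x$ on $\mathbb{C}^{d_1}\otimes\mathbb{C}^{d_2}$; on input $y\in[Y]$ the receiver measures the POVM $\{M_b^y\}_{b\in[B]}$ on the received system and outputs $b$, giving the correlation $P(b|x,y)=\mathrm{Tr}(\rho_xM_b^y)$. The certification is semi-device-independent: the states and measurements are uncharacterized, and the only assumption is that the communicated system has local dimensions $d_1$ and $d_2$. *)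

(* Defs.v *)
From HB Require Import structures.
From mathcomp Require Import all_boot all_order all_algebra.
From mathcomp Require Import all_classical all_reals.
From mathcomp Require Export complex.
From mathcomp Require mxtens.

Set Implicit Arguments.
Unset Strict Implicit.
Unset Printing Implicit Defensive.

Import Order.TTheory GRing.Theory Num.Theory.

Local Open Scope classical_set_scope.
Local Open Scope ring_scope.
Local Open Scope sesquilinear_scope.
Local Open Scope complex_scope.

Section Quantum.
Variable R : realType.
Local Notation C := R[i].

(* In [R[i]], [0 <= z] also says that [z] is real, so self-adjointness of [A]
   is implied. *)
Definition psd (n : nat) (A : 'M[C]_n) : Prop :=
  forall v : 'cV[C]_n, 0 <= (v^t* *m A *m v) ord0 ord0.

Definition density (n : nat) (rho : 'M[C]_n) : Prop :=
  psd rho /\ \tr rho = 1.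

Definition povm (n B : nat) (M : 'I_B -> 'M[C]_n) : Prop :=
  (forall b, psd (M b)) /\ \sum_(b < B) M b = 1%:M.

(* Operators on C^d1 (x) C^d2 are matrices of size d1 * d2, the tensor product
   of operators being the Kronecker product [mxtens.tensmx]. *)
Definition separable (d1 d2 : nat) (rho : 'M[C]_(d1 * d2)) : Prop :=
  density rho /\
  exists (k : nat) (p : 'I_k -> R)
         (s1 : 'I_k -> 'M[C]_d1) (s2 : 'I_k -> 'M[C]_d2),
    [/\ forall i, 0 <= p i,
        \sum_(i < k) p i = 1,
        forall i, density (s1 i),
        forall i, density (s2 i)
      & rho = \sum_(i < k) (p i)%:C *: mxtens.tensmx (s1 i) (s2 i)].

Definition entangled (d1 d2 : nat) (rho : 'M[C]_(d1 * d2)) : Prop :=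
  density rho /\ ~ separable rho.

Definition absolutely_entangled (d1 d2 : nat) (S : set 'M[C]_(d1 * d2)) : Prop :=
  [/\ finite_set S,
      forall rho, S rho -> density rho
    & forall U : 'M[C]_(d1 * d2), U \is unitarymx ->
        exists2 rho, S rho & entangled (U *m rho *m U^t*)].

(* Outcome probabilities are real numbers [P b x y], embedded into [R[i]] to be
   compared with traces. *)
Definition realizes (n X Y B : nat) (P : 'I_B -> 'I_X -> 'I_Y -> R)
    (rho : 'I_X -> 'M[C]_n) (M : 'I_Y -> 'I_B -> 'M[C]_n) : Prop :=
  forall b x y, (P b x y)%:C = \tr (rho x *m M y b).

Definition pm_correlation (n X Y B : nat)
    (P : 'I_B -> 'I_X -> 'I_Y -> R) : Prop :=
  exists (rho : 'I_X -> 'M[C]_n) (M : 'I_Y -> 'I_B -> 'M[C]_n),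
    [/\ forall x, density (rho x), forall y, povm (M y) & realizes P rho M].

Definition witness (X Y B : nat) (alpha P : 'I_B -> 'I_X -> 'I_Y -> R) : R :=
  \sum_(b < B) \sum_(x < X) \sum_(y < Y) alpha b x y * P b x y.

Definition sep_values (d1 d2 X Y B : nat)
    (alpha : 'I_B -> 'I_X -> 'I_Y -> R) : set R :=
  [set q | exists (sigma : 'I_X -> 'M[C]_(d1 * d2))
                  (N : 'I_Y -> 'I_B -> 'M[C]_(d1 * d2)),
    [/\ forall x, separable (sigma x),
        forall y, povm (N y)
      & q%:C = \sum_(b < B) \sum_(x < X) \sum_(y < Y)
                 (alpha b x y)%:C * \tr (sigma x *m N y b)]].

Definition is_maximum (A : set R) (q : R) : Prop := A q /\ ubound A q.

(* [xget] returns the (unique) greatest element when there is one; the default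
   0 is never used below for positive dimensions and alphabets, where the set
   is the image of a nonempty compact set under a continuous function. *)
Definition maximum (A : set R) : R := xget 0 (is_maximum A).

Definition QSEP (d1 d2 X Y B : nat)
    (alpha : 'I_B -> 'I_X -> 'I_Y -> R) : R :=
  maximum (sep_values d1 d2 alpha).

End Quantum.

(* Main.v *)
(* Conjugating the states and the POVM elements by the same unitary preserves
   the correlation, so if some [U] made all [U rho_x U^*] separable, the witness
   value would lie in [sep_values] and be at most [QSEP].  For this [QSEP] must
   be an attained maximum: since the objective is linear in each state, it does
   not decrease when each separable state is replaced by a suitable product
   component of its decomposition, and the families of product states and POVMs
   form a compact set in real coordinates. *)
Require Import Defs.
From mathcomp Require Import all_boot all_order all_algebra.
From mathcomp Require Import all_classical all_reals all_analysis.
From mathcomp Require Import ring lra.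
From mathcomp Require mxtens.

Set Implicit Arguments.
Unset Strict Implicit.
Unset Printing Implicit Defensive.

Import Order.TTheory GRing.Theory Num.Theory Num.Def.
Import numFieldNormedType.Exports.

Local Open Scope classical_set_scope.
Local Open Scope ring_scope.
Local Open Scope sesquilinear_scope.
Local Open Scope complex_scope.

(** * Positive semidefinite matrices, density operators and POVMs *)

Section PositiveSemidefinite.
Variable R : realType.
Local Notation C := R[i].

Lemma trmxC_mul m n p (A : 'M[C]_(m, n)) (B : 'M[C]_(n, p)) :
  (A *m B)^t* = B^t* *m A^t*.
Proof. by rewrite trmx_mul map_mxM. Qed.

Lemma psd_congr m n (A : 'M[C]_n) (T : 'M[C]_(m, n)) :
  psd A -> psd (T *m A *m T^t*).
Proof.
move=> hA v; have := hA (T^t* *m v).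
by rewrite trmxC_mul trmxCK !mulmxA.
Qed.

Lemma psd1 n : psd (1%:M : 'M[C]_n).
Proof.
move=> v; rewrite mulmx1 mxE sumr_ge0 // => i _.
by rewrite !mxE mulrC mul_conjC_ge0.
Qed.

Lemma psd_gramian m n (T : 'M[C]_(m, n)) : psd (T *m T^t*).
Proof. by rewrite -[T in T *m _]mulmx1; apply/psd_congr/psd1. Qed.

(** This is the quadratic form of [A] at the vector [e_i + c e_k]; suitable choices of [c] isolate
    single entries. *)
Lemma psd_pair n (A : 'M[C]_n) i k c : psd A ->
  0 <= A i i + c * A i k + conjC c * A k i + conjC c * c * A k k.
Proof.
move=> /(_ (delta_mx i ord0 + c *: delta_mx k ord0)).
have -> : (delta_mx i ord0 + c *: delta_mx k ord0)^t*
    = delta_mx ord0 i + conjC c *: delta_mx ord0 k :> 'rV[C]_n.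
  apply/rowP => j; rewrite !mxE rmorphD rmorphM !rmorph_nat.
  by rewrite ![_ && (j == _)]andbC.
rewrite !mulmxDl !mulmxDr -!scalemxAl -!scalemxAr -!rowE -!colE !mxE.
congr (0 <= _); ring.
Qed.

Lemma psd_diag_ge0 n (A : 'M[C]_n) i : psd A -> 0 <= A i i.
Proof. by move/(psd_pair i i 0); rewrite conjC0 !mul0r !addr0. Qed.

(** Take [c] = 1, -1, i, -i in [psd_pair]. The vanishing imaginary parts relate [A k i] to [A i k];
    the nonnegative real parts then bound twice each coordinate of [A i k] by [A i i + A k k], hence
    by [2a]. *)
Lemma psd_entry n (A : 'M[C]_n) i k (a : R) : psd A ->
  A i i <= a%:C -> A k k <= a%:C ->
  [/\ complex.Re (A k i) = complex.Re (A i k), complex.Im (A k i) = - complex.Im (A i k),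
      `|complex.Re (A i k)| <= a & `|complex.Im (A i k)| <= a].
Proof.
move=> hA.
have := psd_pair i k 1 hA; have := psd_pair i k (-1) hA.
have := psd_pair i k ('i%C) hA; have := psd_pair i k (- 'i%C) hA.
have := psd_diag_ge0 i hA; have := psd_diag_ge0 k hA.
rewrite -!/(conjc _).
case: (A i i) (A k k) (A i k) (A k i) => [a1 a2] [b1 b2] [x1 x2] [y1 y2].
rewrite !lecE /=.
do 8 (case/andP => /eqP ? ?).
rewrite !ler_norml; split; try (apply/andP; split); lra.
Qed.

Lemma psd_hermitian n (A : 'M[C]_n) : psd A -> A^t* = A.
Proof.
move=> hA; apply/matrixP => i k; rewrite !mxE.
(* A common bound of the two diagonal entries, as [psd_entry] asks; the symmetry relations are what
   is used here. *)
pose a := Num.max (complex.Re (A k k)) (complex.Re (A i i)).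
have le_a j : complex.Re (A j j) <= a -> A j j <= a%:C.
  move=> ha; rewrite lecE ha /= andbT.
  by have /ger0_Im -> := psd_diag_ge0 j hA.
have [||e1 e2 _ _] := @psd_entry _ A k i a hA.
- by apply: le_a; rewrite le_max lexx.
- by apply: le_a; rewrite le_max lexx orbT.
apply/eqP; rewrite eq_complex -/(conjc _).
by case: (A k i) (A i k) e1 e2 => [? ?] [? ?] /= -> ->; rewrite !eqxx.
Qed.

(** By the spectral theorem [A = P^t* D P] with [P] unitary, and [T = P^t* sqrt(D)] works because
    the eigenvalues are nonnegative. *)
Lemma psd_gramianP n (A : 'M[C]_n) :
  psd A -> exists T : 'M[C]_n, A = T *m T^t*.
Proof.
move=> hA; set P := spectralmx A; set D := spectral_diag A.
have uP : P \is unitarymx by exact: spectral_unitarymx.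
have eA : A = P^t* *m diag_mx D *m P.
  rewrite -invmx_unitary //; apply/orthomx_spectralP/hermitian_normalmx.
  by apply/is_hermitianmxP; rewrite expr0 scale1r psd_hermitian.
(* The eigenvalues are the diagonal entries of [P A P^t*], which is positive semidefinite by
   congruence. *)
have D_ge0 i : 0 <= D 0 i.
  have /(psd_diag_ge0 i) := psd_congr P hA.
  rewrite eA !mulmxA (unitarymxP uP) mul1mx -mulmxA (unitarymxP uP) mulmx1.
  by rewrite mxE eqxx mulr1n.
exists (P^t* *m diag_mx (map_mx sqrtC D)).
rewrite trmxC_mul trmxCK !mulmxA -[_ *m _ *m _^t*]mulmxA {1}eA.
congr (_ *m _ *m _).
rewrite tr_diag_mx map_diag_mx mulmx_diag; congr diag_mx.
apply/rowP => i; rewrite !mxE.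
transitivity (sqrtC (D 0 i) * sqrtC (D 0 i)); first by rewrite -expr2 sqrtCK.
by congr (_ * _); apply/esym/geC0_conj; rewrite sqrtC_ge0.
Qed.

(** If [A = S S^t*] and [B = T T^t*], the Kronecker product of [S] and [T] is a Gram factor of that
    of [A] and [B]. *)
Lemma psd_tens m n (A : 'M[C]_m) (B : 'M[C]_n) :
  psd A -> psd B -> psd (mxtens.tensmx A B).
Proof.
move=> /psd_gramianP[S ->] /psd_gramianP[T ->].
rewrite -mxtens.tensmx_mul.
have -> : mxtens.tensmx (S^t*) (T^t*) = (mxtens.tensmx S T)^t*.
  by rewrite mxtens.trmx_tens mxtens.map_mxT.
exact: psd_gramian.
Qed.

Lemma mxtrace_tens m n (A : 'M[C]_m) (B : 'M[C]_n) :
  \tr (mxtens.tensmx A B) = \tr A * \tr B.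
Proof.
rewrite /mxtrace mxtens.mulr_sum; apply: eq_bigr => k _.
by rewrite mxE.
Qed.

Lemma density_tens m n (A : 'M[C]_m) (B : 'M[C]_n) :
  density A -> density B -> density (mxtens.tensmx A B).
Proof.
move=> [hA tA] [hB tB]; split; first exact: psd_tens.
by rewrite mxtrace_tens tA tB mulr1.
Qed.

(** Both matrices are Hermitian, so conjugating the trace turns [A B] into [B A], which has the same
    trace. *)
Lemma mxtrace_psd_real n (A B : 'M[C]_n) :
  psd A -> psd B -> \tr (A *m B) \is Num.real.
Proof.
move=> hA hB; apply/CrealP.
rewrite -[in LHS]mxtrace_tr -trace_map_mx trmxC_mul !psd_hermitian //.
exact: mxtrace_mulC.
Qed.

Lemma separable_tens d1 d2 (s : 'M[C]_d1) (t : 'M[C]_d2) :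
  density s -> density t -> separable (mxtens.tensmx s t).
Proof.
move=> hs ht; split; first exact: density_tens.
exists 1%N, (fun=> 1), (fun=> s), (fun=> t); split=> //.
- by rewrite big_ord1.
- by rewrite big_ord1 scale1r.
Qed.

Lemma density_unitary n (U rho : 'M[C]_n) : U \is unitarymx ->
  density rho -> density (U *m rho *m U^t*).
Proof.
move=> hU [h1 h2]; split; first exact: psd_congr.
by rewrite mxtrace_mulC mulmxA (mulmx1C (unitarymxP hU)) mul1mx.
Qed.

Lemma povm_unitary n B (U : 'M[C]_n) (M : 'I_B -> 'M[C]_n) :
  U \is unitarymx -> povm M -> povm (fun b => U *m M b *m U^t*).
Proof.
move=> hU [h1 h2]; split=> [b|]; first exact/psd_congr/h1.
by rewrite -mulmx_suml -mulmx_sumr h2 mulmx1; apply/unitarymxP.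
Qed.

Lemma density_diag_le1 n (A : 'M[C]_n) i : density A -> A i i <= 1.
Proof.
move=> [hA <-]; rewrite /mxtrace (bigD1 i) //= lerDl sumr_ge0 // => j _.
exact: psd_diag_ge0.
Qed.

(** For fixed [i] the diagonal entries are nonnegative and sum to 1 over the outcomes. *)
Lemma povm_diag_le1 n B (M : 'I_B -> 'M[C]_n) b i : povm M -> M b i i <= 1.
Proof.
move=> [h1 /matrixP/(_ i i)]; rewrite mxE eqxx mulr1n => <-.
rewrite summxE (bigD1 b) //= lerDl sumr_ge0 // => j _; exact/psd_diag_ge0.
Qed.

End PositiveSemidefinite.

(** * Continuity of complex-valued maps and closedness of the constraints *)

Section ComplexContinuity.
Variables (R : realType) (S : topologicalType).
Local Notation C := R[i].

(** Phrased through real coordinates, so that closedness and extreme values reduce to facts about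
    real functions. *)
Definition complex_continuous (f : S -> C) : Prop :=
  continuous (fun s => complex.Re (f s)) /\
  continuous (fun s => complex.Im (f s)).

Definition mx_continuous m n (F : S -> 'M[C]_(m, n)) : Prop :=
  forall i j, complex_continuous (fun s => F s i j).

Lemma complex_continuous_cst (c : C) : complex_continuous (fun=> c).
Proof. by split=> s; exact: cvg_cst. Qed.

Lemma complex_continuousD (f g : S -> C) :
  complex_continuous f -> complex_continuous g ->
  complex_continuous (fun s => f s + g s).
Proof.
move=> [f1 f2] [g1 g2]; split=> s.
- rewrite (_ : (fun s => _) = fun s => complex.Re (f s) + complex.Re (g s)).
    by apply: cvgD; [exact: f1|exact: g1].
  by apply/funext => t; case: (f t) (g t) => [? ?] [? ?].
- rewrite (_ : (fun s => _) = fun s => complex.Im (f s) + complex.Im (g s)).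
    by apply: cvgD; [exact: f2|exact: g2].
  by apply/funext => t; case: (f t) (g t) => [? ?] [? ?].
Qed.

Lemma complex_continuousM (f g : S -> C) :
  complex_continuous f -> complex_continuous g ->
  complex_continuous (fun s => f s * g s).
Proof.
move=> [f1 f2] [g1 g2]; split=> s.
- rewrite (_ : (fun s => _) = fun s => complex.Re (f s) * complex.Re (g s)
                                    - complex.Im (f s) * complex.Im (g s)).
    by apply: cvgB; apply: cvgM; do ?[exact: f1|exact: f2|exact: g1|exact: g2].
  by apply/funext => t; case: (f t) (g t) => [? ?] [? ?].
- rewrite (_ : (fun s => _) = fun s => complex.Re (f s) * complex.Im (g s)
                                    + complex.Im (f s) * complex.Re (g s)).
    by apply: cvgD; apply: cvgM; do ?[exact: f1|exact: f2|exact: g1|exact: g2].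
  by apply/funext => t; case: (f t) (g t) => [? ?] [? ?].
Qed.

Lemma complex_continuous_sum (I : Type) (r : seq I) (F : I -> S -> C) :
  (forall i, complex_continuous (F i)) ->
  complex_continuous (fun s => \sum_(i <- r) F i s).
Proof.
move=> hF; elim: r => [|i r IH].
  under eq_fun do rewrite big_nil; exact: complex_continuous_cst.
by under eq_fun do rewrite big_cons; exact: complex_continuousD.
Qed.

Lemma mx_continuous_cst m n (A : 'M[C]_(m, n)) : mx_continuous (fun=> A).
Proof. by move=> i j; exact: complex_continuous_cst. Qed.

Lemma mx_continuousM m n p (F : S -> 'M[C]_(m, n)) (G : S -> 'M[C]_(n, p)) :
  mx_continuous F -> mx_continuous G -> mx_continuous (fun s => F s *m G s).
Proof.
move=> hF hG i j; under eq_fun do rewrite mxE.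
by apply: complex_continuous_sum => k; exact: complex_continuousM.
Qed.

Lemma mx_continuous_tens m n p q
    (F : S -> 'M[C]_(m, n)) (G : S -> 'M[C]_(p, q)) :
  mx_continuous F -> mx_continuous G ->
  mx_continuous (fun s => mxtens.tensmx (F s) (G s)).
Proof.
by move=> hF hG i j; under eq_fun do rewrite mxE; exact: complex_continuousM.
Qed.

Lemma complex_continuous_tr n (F : S -> 'M[C]_n) :
  mx_continuous F -> complex_continuous (fun s => \tr (F s)).
Proof. by move=> hF; apply: complex_continuous_sum. Qed.

Lemma closed_complex_eq (f : S -> C) (c : C) :
  complex_continuous f -> closed [set s | f s = c].
Proof.
move=> [f1 f2].
rewrite (_ : [set s | _] =
  (fun s => complex.Re (f s)) @^-1` [set x | x = complex.Re c] `&`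
  (fun s => complex.Im (f s)) @^-1` [set x | x = complex.Im c]).
  apply: closedI; apply: (preimage_closed _ (@closed_eq R _)) => s _.
    exact: f1.
  exact: f2.
apply/seteqP; split=> s /=; first by move=> ->.
by case: (f s) c => [? ?] [? ?] /= [-> ->].
Qed.

Lemma closed_complex_ge0 (f : S -> C) :
  complex_continuous f -> closed [set s | 0 <= f s].
Proof.
move=> [f1 f2].
rewrite (_ : [set s | _] =
  (fun s => complex.Re (f s)) @^-1` [set x | 0 <= x] `&`
  (fun s => complex.Im (f s)) @^-1` [set x | x = 0]).
  apply: closedI.
    by apply: (preimage_closed _ (@closed_ge R 0)) => s _; exact: f1.
  by apply: (preimage_closed _ (@closed_eq R 0)) => s _; exact: f2.
apply/seteqP; split=> s /=; rewrite lecE /=.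
  by move=> /andP[/eqP ? ?].
by move=> [-> ->]; rewrite eqxx.
Qed.

(** Each fixed vector imposes a closed condition, and arbitrary intersections of closed sets are
    closed. *)
Lemma closed_psd n (F : S -> 'M[C]_n) :
  mx_continuous F -> closed [set s | psd (F s)].
Proof.
move=> hF.
rewrite (_ : [set s | _] = \bigcap_(v in [set: 'cV[C]_n])
    [set s | 0 <= (v^t* *m F s *m v) ord0 ord0]).
  apply: closed_bigI => v _; apply: closed_complex_ge0.
  by do 2?apply: mx_continuousM => //; exact: mx_continuous_cst.
by apply/seteqP; split=> s h v; [move=> _; exact: h|exact: (h v I)].
Qed.

Lemma closed_density n (F : S -> 'M[C]_n) :
  mx_continuous F -> closed [set s | density (F s)].
Proof.
move=> hF; apply: closedI; first exact: closed_psd.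
exact/closed_complex_eq/complex_continuous_tr.
Qed.

Lemma closed_povm n B (F : S -> 'I_B -> 'M[C]_n) :
  (forall b, mx_continuous (F^~ b)) -> closed [set s | povm (F s)].
Proof.
move=> hF.
rewrite (_ : [set s | _] =
  (\bigcap_(b in [set: 'I_B]) [set s | psd (F s b)]) `&`
  \bigcap_(ij in [set: 'I_n * 'I_n])
    [set s | \sum_b F s b ij.1 ij.2 = (1%:M : 'M[C]_n) ij.1 ij.2]).
  apply: closedI; apply: closed_bigI => i _; first exact: closed_psd.
  by apply: closed_complex_eq; apply: complex_continuous_sum => b; exact: hF.
apply/seteqP; split=> s [h1 h2]; split.
- by move=> b _; exact: h1.
- by move=> ij _ /=; rewrite -h2 summxE.
- by move=> b; exact: (h1 b I).
- by apply/matrixP => i j; rewrite summxE; exact: (h2 (i, j) I).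
Qed.

End ComplexContinuity.

(** * Compactness in real matrix coordinates *)

Section MatrixCoordinates.
Variables (R : realType) (J : eqType) (n : J -> nat).
Local Notation C := R[i].

(* Real coordinates of a [J]-indexed family of complex matrices; the boolean
   selects the real or the imaginary part of an entry. *)
Definition mx_index := {j : J & ('I_(n j) * 'I_(n j) * bool)%type}.

(** Pointwise convergence is the product topology, which makes each coordinate continuous and lets
    Tychonoff's theorem apply. *)
Definition mx_of_coords (f : {ptws mx_index -> R}) (j : J) : 'M[C]_(n j) :=
  \matrix_(i, k) (f (existT _ j (i, k, true)) +i* f (existT _ j (i, k, false))).

Definition coords_of_mx (A : forall j, 'M[C]_(n j)) (t : mx_index) : R :=
  let: (i, k, b) := tagged t in
  if b then complex.Re (A (tag t) i k) else complex.Im (A (tag t) i k).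

Lemma coords_of_mxK A j : mx_of_coords (coords_of_mx A) j = A j.
Proof. by apply/matrixP => i k; rewrite mxE /coords_of_mx /=; case: (A j i k). Qed.

Lemma mx_of_coords_continuous j :
  mx_continuous (S := {ptws mx_index -> R}) (mx_of_coords ^~ j).
Proof.
move=> i k; split.
- rewrite (_ : (fun _ => _) = proj (existT _ j (i, k, true))).
    exact: (@proj_continuous _ (fun=> R)).
  by apply/funext => f; rewrite mxE.
- rewrite (_ : (fun _ => _) = proj (existT _ j (i, k, false))).
    exact: (@proj_continuous _ (fun=> R)).
  by apply/funext => f; rewrite mxE.
Qed.

(** By [psd_entry] with bound 1, all coordinates lie in [-1, 1], so [K] is a closed subset of a
    compact cube. *)
Lemma compact_psd_coords (K : set {ptws mx_index -> R}) :
  closed K ->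
  (forall f j, K f ->
     psd (mx_of_coords f j) /\ forall i, mx_of_coords f j i i <= 1) ->
  compact K.
Proof.
move=> cK hK.
apply: (@subclosed_compact {ptws mx_index -> R} _
  [set f | forall t, `[-1, 1]%classic (f t)]) => //.
  apply: (@tychonoff mx_index (fun=> R) (fun=> `[-1, 1]%classic)) => t.
  exact: segment_compact.
move=> f /hK h [j [[i k] b]] /=; have [hp h1] := h j.
have [_ _] := psd_entry (i := i) (k := k) (a := 1) hp (h1 i) (h1 k).
by rewrite !mxE /= !ler_norml in_itv /=; case: b.
Qed.

End MatrixCoordinates.

(** * Attainment of the separable maximum at product states *)

Section ProductOptimum.
Variables (R : realType) (d1 d2 X Y B : nat).
Local Notation C := R[i].
Variable alpha : 'I_B -> 'I_X -> 'I_Y -> R.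

Lemma Re_sum (I : Type) (r : seq I) (F : I -> C) :
  complex.Re (\sum_(i <- r) F i) = \sum_(i <- r) complex.Re (F i).
Proof. by apply: big_morph => // -[? ?] [? ?]. Qed.

(** The left side is the average, with weights [p i], of the values [g i] at the product components,
    so some component reaches it. *)
Lemma separable_le_product (rho G : 'M[C]_(d1 * d2)) : separable rho ->
  exists s : 'M[C]_d1 * 'M[C]_d2, [/\ density s.1, density s.2 &
    complex.Re (\tr (rho *m G)) <=
    complex.Re (\tr (mxtens.tensmx s.1 s.2 *m G))].
Proof.
move=> [_ [k [p [s1 [s2 [p_ge0 p1 h1 h2 erho]]]]]].
pose g i := complex.Re (\tr (mxtens.tensmx (s1 i) (s2 i) *m G)).
have eG : complex.Re (\tr (rho *m G)) = \sum_i p i * g i.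
  rewrite erho mulmx_suml [\tr _]raddf_sum /= Re_sum; apply: eq_bigr => i _.
  rewrite -scalemxAl mxtraceZ /g.
  by case: (\tr _) => a b /=; rewrite mul0r subr0.
suff [i hi] : exists i, complex.Re (\tr (rho *m G)) <= g i.
  by exists (s1 i, s2 i); split; [exact: h1|exact: h2|exact: hi].
apply: contrapT => /forallNP h.
have lt_g i : g i < complex.Re (\tr (rho *m G)) by rewrite ltNge; exact/negP/h.
(* If every [g i] were below the average, this vanishing sum of nonnegative terms would force all
   weights to be 0, against their sum 1. *)
have sum0 : \sum_i p i * (complex.Re (\tr (rho *m G)) - g i) = 0.
  under eq_bigr do rewrite mulrBr.
  by rewrite sumrB -mulr_suml p1 mul1r -eG subrr.
have p0 i : p i = 0.
  have /(_ i isT)/eqP : forall j, true ->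
      p j * (complex.Re (\tr (rho *m G)) - g j) = 0.
    apply: psumr_eq0P sum0 => j _.
    by rewrite mulr_ge0 ?p_ge0// subr_ge0 ltW.
  by rewrite mulf_eq0 subr_eq0 [_ == g i]gt_eqF ?lt_g// orbF => /eqP.
by move: p1; rewrite big1// => /eqP; rewrite eq_sym oner_eq0.
Qed.

Definition score n (sigma : 'I_X -> 'M[C]_n) (N : 'I_Y -> 'I_B -> 'M[C]_n) : C :=
  \sum_(b < B) \sum_(x < X) \sum_(y < Y)
    (alpha b x y)%:C * \tr (sigma x *m N y b).

(** For fixed measurements the objective splits into one linear functional per input [x], so each
    state can be improved separately. *)
Lemma scoreE n (sigma : 'I_X -> 'M[C]_n) (N : 'I_Y -> 'I_B -> 'M[C]_n) :
  score sigma N =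
  \sum_x \tr (sigma x *m \sum_b \sum_y (alpha b x y)%:C *: N y b).
Proof.
rewrite /score exchange_big; apply: eq_bigr => x _.
rewrite mulmx_sumr raddf_sum; apply: eq_bigr => b _.
rewrite mulmx_sumr raddf_sum; apply: eq_bigr => y _.
by rewrite -scalemxAr /= mxtraceZ.
Qed.

Lemma score_real n (sigma : 'I_X -> 'M[C]_n) (N : 'I_Y -> 'I_B -> 'M[C]_n) :
  (forall x, density (sigma x)) -> (forall y, povm (N y)) ->
  score sigma N \is Num.real.
Proof.
move=> hs hN; rewrite /score.
apply: rpred_sum => b _; apply: rpred_sum => x _; apply: rpred_sum => y _.
apply: rpredM.
  by apply/complex_realP; eexists.
by apply: mxtrace_psd_real; [case: (hs x)|case: (hN y)].
Qed.

(** Labels of the matrices making up a product strategy: first factors, second factors, POVM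
    elements. *)
Let J : Type := ('I_X + 'I_X + 'I_Y * 'I_B)%type.
Let dim (j : J) : nat :=
  match j with inl (inl _) => d1 | inl (inr _) => d2 | inr _ => d1 * d2 end.
Let coords := {ptws mx_index dim -> R}.
Let left (f : coords) x : 'M[C]_d1 := mx_of_coords f (inl (inl x)).
Let right (f : coords) x : 'M[C]_d2 := mx_of_coords f (inl (inr x)).
Let meas (f : coords) y b : 'M[C]_(d1 * d2) := mx_of_coords f (inr (y, b)).

Let left_continuous x : mx_continuous (left^~ x).
Proof. exact: (@mx_of_coords_continuous R _ dim (inl (inl x))). Qed.

Let right_continuous x : mx_continuous (right^~ x).
Proof. exact: (@mx_of_coords_continuous R _ dim (inl (inr x))). Qed.

Let meas_continuous y b : mx_continuous (fun f => meas f y b).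
Proof. exact: (@mx_of_coords_continuous R _ dim (inr (y, b))). Qed.

Let feasible : set coords :=
  (\bigcap_(x in [set: 'I_X]) [set f | density (left f x)]) `&`
  (\bigcap_(x in [set: 'I_X]) [set f | density (right f x)]) `&`
  (\bigcap_(y in [set: 'I_Y]) [set f | povm (meas f y)]).

Let value (f : coords) : R :=
  complex.Re (score (fun x => mxtens.tensmx (left f x) (right f x)) (meas f)).

Let compact_feasible : compact feasible.
Proof.
apply: compact_psd_coords => [|f [[x|x]|[y b]] [[hl hr] hm]].
- apply: closedI; first apply: closedI; apply: closed_bigI => i _.
  + by apply: closed_density; exact: left_continuous.
  + by apply: closed_density; exact: right_continuous.
  + by apply: closed_povm => b; exact: meas_continuous.
- have h := hl x I; split; first by case: h.
  by move=> i; exact: (density_diag_le1 i h).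
- have h := hr x I; split; first by case: h.
  by move=> i; exact: (density_diag_le1 i h).
- have h := hm y I; split; first exact: h.1.
  by move=> i; exact: (povm_diag_le1 b i h).
Qed.

Let continuous_value : continuous value.
Proof.
have [//] : complex_continuous (S := coords)
  (fun f => score (fun x => mxtens.tensmx (left f x) (right f x)) (meas f)).
do 3!apply: complex_continuous_sum => ?.
apply: complex_continuousM; first exact: complex_continuous_cst.
apply/complex_continuous_tr/mx_continuousM; last exact: meas_continuous.
by apply: mx_continuous_tens; [exact: left_continuous|exact: right_continuous].
Qed.

(** Keep the measurements and replace each state by a product component that scores at least as
    well. *)
Let sep_value_le_product (q : R) : sep_values d1 d2 alpha q ->
  exists2 f, feasible f & q <= value f.
Proof.
move=> [sigma [N [hs hN eq]]].
(* The operator that [scoreE] pairs with the state on input [x]. *)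
pose G x := \sum_b \sum_y (alpha b x y)%:C *: N y b.
have [s hs'] := choice (fun x => separable_le_product (G x) (hs x)).
pose A (j : J) : 'M[C]_(dim j) := match j with
  | inl (inl x) => (s x).1 | inl (inr x) => (s x).2 | inr (y, b) => N y b end.
have eL x : left (coords_of_mx A) x = (s x).1.
  exact: (coords_of_mxK A (inl (inl x))).
have eR x : right (coords_of_mx A) x = (s x).2.
  exact: (coords_of_mxK A (inl (inr x))).
have eN y b : meas (coords_of_mx A) y b = N y b.
  exact: (coords_of_mxK A (inr (y, b))).
exists (coords_of_mx A).
  split; first split.
  - by move=> x _ /=; rewrite eL; case: (hs' x).
  - by move=> x _ /=; rewrite eR; case: (hs' x).
  - by move=> y _ /=; rewrite (_ : meas _ y = N y)//; exact/funext.
have -> : q = complex.Re (score sigma N) by rewrite /score -eq.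
rewrite /value !scoreE !Re_sum; apply: ler_sum => x _.
under [X in _ <= complex.Re (\tr (_ *m X))]eq_bigr do
  under eq_bigr do rewrite eN.
by rewrite eL eR; case: (hs' x).
Qed.

(** The extreme value theorem gives a best product strategy [c]; its value dominates all separable
    values and is itself one of them. *)
Lemma sep_values_has_maximum : sep_values d1 d2 alpha !=set0 ->
  exists q, is_maximum (sep_values d1 d2 alpha) q.
Proof.
move=> [q0 /sep_value_le_product[f0 f0K _]].
have [|c /set_mem[[hl hr] hm] cmax] := compact_EVT_max _ compact_feasible
  (continuous_subspaceT continuous_value).
  by exists f0.
exists (value c); split=> [|q /sep_value_le_product[f fK /le_trans]]; last first.
  by apply; apply: cmax; exact: mem_set.
exists (fun x => mxtens.tensmx (left c x) (right c x)), (meas c).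
have hsep x : separable (mxtens.tensmx (left c x) (right c x)).
  by apply: separable_tens; [exact: (hl x I)|exact: (hr x I)].
split=> [//|y|]; first exact: (hm y I).
(* [value] is only a real part; it equals the whole score because the score is real. *)
apply: RRe_real; apply: score_real => [x|y]; last exact: (hm y I).
by case: (hsep x).
Qed.

Lemma sep_value_le_QSEP (q : R) :
  sep_values d1 d2 alpha q -> q <= QSEP d1 d2 alpha.
Proof.
move=> hq; have [m hm] : exists m, is_maximum (sep_values d1 d2 alpha) m.
  by apply: sep_values_has_maximum; exists q.
(* Since a maximum exists, [xget] returns one and not its default 0. *)
by have [_] := xgetPex 0 (ex_intro _ m hm); apply.
Qed.

End ProductOptimum.

(** * Unitary invariance of the correlation and certification *)

Theorem proposition1 (R : realType) (d1 d2 X Y B : nat)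
  (hd1 : (0 < d1)%N) (hd2 : (0 < d2)%N)
  (hX : (0 < X)%N) (hY : (0 < Y)%N) (hB : (0 < B)%N)
  (alpha : 'I_B -> 'I_X -> 'I_Y -> R)
  (P : 'I_B -> 'I_X -> 'I_Y -> R)
  (hP : pm_correlation (d1 * d2) P)
  (hw : QSEP d1 d2 alpha < witness alpha P)
  (rho : 'I_X -> 'M[R[i]]_(d1 * d2))
  (M : 'I_Y -> 'I_B -> 'M[R[i]]_(d1 * d2))
  (hrho : forall x, density (rho x))
  (hM : forall y, povm (M y))
  (hPM : realizes P rho M) :
  absolutely_entangled (range rho).
Proof.
split=> [|_ [x _ <-]|U hU]; [exact: finite_image|exact: hrho|].
apply: contrapT => noent.
have hsep x : separable (U *m rho x *m U^t*).
  apply: contrapT => hx; apply: noent; exists (rho x); first by exists x.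
  by split=> //; exact: density_unitary.
(* The rotated states are separable and, with the rotated POVMs, still realize [P], which
   contradicts [hw]. *)
suff /sep_value_le_QSEP : sep_values d1 d2 alpha (witness alpha P).
  by rewrite leNgt hw.
exists (fun x => U *m rho x *m U^t*), (fun y b => U *m M y b *m U^t*).
split=> [//|y|]; first exact: povm_unitary.
rewrite /witness; do 3!(rewrite rmorph_sum; apply: eq_bigr => ? _).
rewrite rmorphM /= hPM; congr (_ * _).
(* The inner pair [U^t* U] cancels directly, the outer pair after a cyclic shift under the trace. *)
rewrite !mulmxA -[_ *m U^t* *m U]mulmxA (mulmx1C (unitarymxP hU)) mulmx1.
by rewrite [RHS]mxtrace_mulC !mulmxA (mulmx1C (unitarymxP hU)) mul1mx.
Qed.
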